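(* For every integer $j \geq 1$, the function $\mathrm{prh}_j$ is injective on the set of all partitions.
   Context: A partition $\lambda=(\lambda_1,\ldots,\lambda_\ell)$ is a weakly decreasing finite sequence of positive integers, identified with its multiset of parts. For $j\ge 1$, $\mathrm{prh}_j(\lambda)$ is the partition whose multiset of parts is $\{\!\{\lambda_{i_1}\cdots\lambda_{i_j} : 1\le i_1\le i_2\le\cdots\le i_j\le \ell\}\!\}$ (one part for each weakly increasing sequence of $j$ indices in $\{1,\ldots,\ell\}$, counted with multiplicity). *)

(* Defs.v *)
From HB Require Import structures.
From mathcomp Require Import all_boot.

Set Implicit Arguments.
Unset Strict Implicit.
Unset Printing Implicit Defensive.

Definition is_intpart (s : seq nat) : bool :=
  sorted geq s && all (fun x => 0 < x) s.

Record intpart : Type := IntPart {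
  parts :> seq nat;
  _ : is_intpart parts
}.

HB.instance Definition _ := [isSub for parts].
HB.instance Definition _ := [Countable of intpart by <:].

(* Index sequences are the weakly increasing j-tuples over 'I_(size la), so
   indices start at 0. *)
Definition prh_seq (j : nat) (la : intpart) : seq nat :=
  [seq \prod_(k < j) tnth (in_tuple la) (tnth t k)
     | t <- enum [set t : j.-tuple 'I_(size la) | sorted leq (map val t)]].

Lemma prh_subproof (j : nat) (la : intpart) :
  is_intpart (sort geq (prh_seq j la)).
Proof.
apply/andP; split; first by apply: sort_sorted => m n; exact: leq_total.
rewrite all_sort; apply/allP => _ /mapP[t _ ->].
rewrite prodn_gt0 // => k.
have /andP[_ /allP la_gt0] := valP la.
by apply: la_gt0; exact: mem_tnth.
Qed.

Definition prh (j : nat) (la : intpart) : intpart :=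
  IntPart (prh_subproof j la).

(* Main.v *)
Require Import Defs.
From mathcomp Require Import all_boot.

(** Two distinct partitions are [p ++ x :: s1] and [p ++ s2] with all parts of
    [s2] smaller than [x], up to exchanging them. If [M] is the largest part of
    the first one, the product [v := M ^ j.-1 * x] occurs strictly more often in
    its image: a product in the second one that involves a part of [s2] is
    smaller than [v], so the products equal to [v] there only involve parts of
    [p] and also occur in the first one, which has in addition the product
    [M ^ j.-1 * x] itself. *)

Lemma sorted_geq_neq (s t : seq nat) :
  sorted geq s -> sorted geq t -> s <> t ->
  exists p x s1 s2,
    (s = p ++ x :: s1 /\ t = p ++ s2 \/ t = p ++ x :: s1 /\ s = p ++ s2)
    /\ all (gtn x) s2.
Proof.
have geq_tr : transitive geq by move=> b a c ab bc; exact: leq_trans bc ab.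
have tail_lt a b u : sorted geq (b :: u) -> b < a -> all (gtn a) (b :: u).
  move=> /= /(order_path_min geq_tr)/allP ub ba; rewrite ba /=.
  by apply/allP => c /ub cb; exact: leq_ltn_trans cb ba.
(* The prefix [p] collects the equal heads, and [x] is the larger entry at the first difference. If
   one list is exhausted first, [s2] is empty. *)
elim: s t => [|a s IHs] [|b t] //= sS sT neq.
- by exists [::], b, t, [::]; split => //; right.
- by exists [::], a, s, [::]; split => //; left.
case: (ltngtP a b) => [ab|ba|ab].
- by exists [::], b, t, (a :: s); split; [right | exact: tail_lt].
- by exists [::], a, s, (b :: t); split; [left | exact: tail_lt].
have [|p [x [s1 [s2 [st s2x]]]]] := IHs t (path_sorted sS) (path_sorted sT).
  by move=> st; apply: neq; rewrite ab st.
exists (a :: p), x, s1, s2; split => //.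
by rewrite -ab; case: st => -[-> ->]; [left | right].
Qed.

Lemma prod_leq_expn (I : Type) (r : seq I) (F : I -> nat) (M : nat) :
  (forall i, F i <= M) -> \prod_(i <- r) F i <= M ^ size r.
Proof.
move=> FM; elim: r => [|i r IHr]; first by rewrite big_nil.
by rewrite big_cons expnS leq_mul.
Qed.

(** Split off one occurrence of [i]: the other factors contribute at most a power of [M], and
    [0 < M] keeps the inequality strict. *)
Lemma prod_ltn_expn (I : eqType) (r : seq I) (F : I -> nat) (M x : nat) (i : I) :
  0 < M -> (forall i, F i <= M) -> i \in r -> F i < x ->
  \prod_(i <- r) F i < M ^ (size r).-1 * x.
Proof.
move=> M_gt0 FM ir Fix; rewrite (big_rem i ir) /= mulnC -(size_rem ir).
apply: (@leq_ltn_trans (M ^ size (rem i r) * F i)).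
  by rewrite leq_mul2r prod_leq_expn ?orbT.
by rewrite ltn_pmul2l // expn_gt0 M_gt0.
Qed.

(** Taking a bare sequence lets a partition be rewritten as a concatenation without carrying its
    validity proof along. *)
Definition prh_fiber (j : nat) (s : seq nat) (v : nat) :
    {set j.-tuple 'I_(size s)} :=
  [set t : j.-tuple 'I_(size s) |
    sorted leq (map val t) && (\prod_(i <- t) nth 0 s i == v)].

Lemma count_prh_seq (j : nat) (la : intpart) (v : nat) :
  count_mem v (prh_seq j la) = #|prh_fiber j la v|.
Proof.
rewrite /prh_seq count_map -sum1_count big_enum_cond /= -sum1_card.
apply: eq_bigl => t; rewrite !inE big_tuple.
by congr (_ && (_ == _)); apply: eq_bigr => k _; rewrite (tnth_nth 0).
Qed.

Lemma ltn_card_prh_fiber (j : nat) (p s1 s2 : seq nat) (x : nat) :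
  sorted geq (p ++ x :: s1) -> all (gtn x) s2 -> 0 < x ->
  exists v, #|prh_fiber j.+1 (p ++ s2) v| < #|prh_fiber j.+1 (p ++ x :: s1) v|.
Proof.
set la := p ++ x :: s1; set mu := p ++ s2 => la_sorted s2x x_gt0.
have la_p : size p < size la by rewrite size_cat /= -addSnnS leq_addr.
have la_gt0 : 0 < size la by exact: leq_ltn_trans la_p.
have la_x : nth 0 la (size p) = x by rewrite nth_cat ltnn subnn.
have la_p_mu i : i < size p -> nth 0 la i = nth 0 mu i.
  by move=> ip; rewrite !nth_cat ip.
(* No upper bound on [i] is required: past the end of [mu] the default value 0 is still below
   [x]. *)
have mu_lt i : size p <= i -> nth 0 mu i < x.
  move=> pi; rewrite nth_cat [i < _]ltnNge pi /=.
  have [i_lt|i_ge] := ltnP (i - size p) (size s2).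
    by move/allP: s2x => /(_ _ (mem_nth 0 i_lt)).
  by rewrite nth_default.
set M := nth 0 la 0.
have la_le i : i < size la -> nth 0 la i <= M.
  move=> i_lt; apply: (sorted_leq_nth _ _ 0 la_sorted 0 i) => //.
    by move=> b a c ab bc; exact: leq_trans bc ab.
  exact: leqnn.
have x_le : x <= M by rewrite -la_x la_le.
have mu_le i : nth 0 mu i <= M.
  have [ip|pi] := ltnP i (size p); last exact: leq_trans (ltnW (mu_lt i pi)) x_le.
  by rewrite -la_p_mu // la_le // (ltn_trans ip).
have M_gt0 : 0 < M by exact: leq_trans x_le.
exists (M ^ j * x).
pose i0 : 'I_(size la) := Ordinal la_gt0; pose ip : 'I_(size la) := Ordinal la_p.
(* The extra tuple: [j] times the index of [M], then the index of [x]. *)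
pose t0 : j.+1.-tuple 'I_(size la) := [tuple of rcons (nseq j i0) ip].
(* An index too large for [la] is sent to the dummy value [ip]; on the fiber only indices of [p]
   occur, and these are kept. *)
pose f (i : 'I_(size mu)) : 'I_(size la) := insubd ip (val i).
pose F (t : j.+1.-tuple 'I_(size mu)) : j.+1.-tuple 'I_(size la) :=
  [tuple of map f t].
have small t : t \in prh_fiber j.+1 mu (M ^ j * x) ->
    forall i, i \in t -> val i < size p.
  rewrite inE => /andP[_ /eqP tv] i it; rewrite ltnNge; apply/negP => pi.
  have := @prod_ltn_expn _ t (fun i => nth 0 mu i) M x i M_gt0
    (fun i => mu_le i) it (mu_lt i pi).
  by rewrite tv size_tuple ltnn.
have f_val (i : 'I_(size mu)) : val i < size p -> val (f i) = val i.
  by move=> ilt; rewrite val_insubd (ltn_trans ilt la_p).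
have F_val t : t \in prh_fiber j.+1 mu (M ^ j * x) ->
    map val (F t) = map val t.
  move=> /small tp; rewrite /= -map_comp.
  by apply/eq_in_map => i /tp; exact: f_val.
(* [F] preserves index values on the fiber of [mu], hence is injective there; its image is then
   shown to be a proper subset of the fiber of [la]. *)
rewrite -(@card_in_imset _ _ F); last first.
  move=> t u tA uA Ftu; apply/val_inj/(inj_map val_inj).
  by rewrite -F_val // Ftu F_val.
apply/proper_card/properP; split.
  apply/subsetP => _ /imsetP[t tA ->]; move: (tA).
  rewrite !inE F_val // => /andP[-> /eqP <-] /=.
  rewrite big_map; apply/eqP/eq_big_seq => i it.
  have ilt := small t tA i it.
  by rewrite -la_p_mu // -(f_val i ilt : nat_of_ord (f i) = i).
exists t0.
  rewrite inE; apply/andP; split.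
    rewrite /= map_rcons map_nseq /=.
    case: (j) => // n; rewrite /= rcons_path.
    have -> : last 0 (nseq n 0) = 0 by elim: n.
    by rewrite andbT; elim: n.
  by rewrite /= -cats1 big_cat big_seq1 /= la_x big_nseq iter_muln_1.
(* [t0] uses the index [size p], whereas tuples in the image only use smaller ones. *)
apply/imsetP => -[t tA t0F].
have : val ip \in map val (F t).
  by rewrite -t0F map_f //= mem_rcons mem_head.
by rewrite F_val // => /mapP[i /(small t tA) + pi]; rewrite -pi /= ltnn.
Qed.

Theorem theorem5p1 (j : nat) (hj : 1 <= j) : injective (prh j).
Proof.
case: j hj => // j _ la mu prh_eq.
have fibers v : #|prh_fiber j.+1 la v| = #|prh_fiber j.+1 mu v|.
  suff /permP pe : perm_eq (prh_seq j.+1 la) (prh_seq j.+1 mu).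
    by rewrite -!count_prh_seq pe.
  have := congr1 parts prh_eq => /= sort_eq.
  by rewrite -(perm_sort geq) sort_eq perm_sort.
(* Stated for arbitrary [a] and [b], since either partition may be the one that contains [x]. *)
have distinct (a b : intpart) p x s1 s2 :
    (forall v, #|prh_fiber j.+1 a v| = #|prh_fiber j.+1 b v|) ->
    parts a = p ++ x :: s1 -> parts b = p ++ s2 -> ~~ all (gtn x) s2.
  move=> ab aE bE; apply/negP => s2x.
  have /andP[a_sorted /allP a_gt0] := valP a; move: ab a_sorted a_gt0.
  rewrite /= aE bE => ab a_sorted a_gt0.
  have x_gt0 : 0 < x by apply: a_gt0; rewrite mem_cat mem_head orbT.
  have [v] := ltn_card_prh_fiber j _ _ _ _ a_sorted s2x x_gt0.
  by rewrite ab ltnn.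
have /andP[la_sorted _] := valP la; have /andP[mu_sorted _] := valP mu.
apply/val_inj/eqP/negPn/negP => /eqP neq.
have [p [x [s1 [s2 [[[laE muE]|[muE laE]] s2x]]]]] :=
  sorted_geq_neq _ _ la_sorted mu_sorted neq.
  by have := distinct _ _ _ _ _ _ fibers laE muE; rewrite s2x.
by have := distinct _ _ _ _ _ _ (fsym fibers) muE laE; rewrite s2x.
Qed.
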